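(* Let $M>0$ and let $f(z)=h(z)+\overline{g(z)}$ be a harmonic mapping of the unit disk $U$, where $h(z)=\sum_{n=1}^{\infty}a_nz^n$ and $g(z)=\sum_{n=1}^{\infty}b_nz^n$ are analytic on $U$. If $|h(z)|+|g(z)|\le M$ for all $z\in U$, then $0\le\lambda_f(0)\le M$ and $$|a_n|+|b_n|\le M-\frac{\lambda_f^2(0)}{M}\qquad\text{for all } n=2,3,\dots.$$ These estimates are sharp for all $n=2,3,\dots$: for each $n\ge 2$ and each $a$ with $0\le a\le M$, the functions $f_{a,n}(z)$ and $\overline{f_{a,n}(z)}$, where $$f_{a,n}(z)=Mz\cdot\frac{a-Mz^{n-1}}{M-az^{n-1}},$$ are extremal, i.e. they satisfy the hypotheses and give equality in the estimate with index $n$, with $\lambda_f(0)=a$.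
   Context: $U=\{z\in\mathbb{C}:|z|<1\}$ is the open unit disk. A harmonic mapping is a complex-valued harmonic function (not assumed injective). For a differentiable complex-valued function $f$, with $z=x+iy$, put $f_z=\frac12(f_x-if_y)$, $f_{\overline z}=\frac12(f_x+if_y)$, and $\lambda_f(z)=\bigl||f_z(z)|-|f_{\overline z}(z)|\bigr|$. In particular, for $f=h+\overline g$ as in the claim, $\lambda_f(0)=\bigl||a_1|-|b_1|\bigr|$. *)

(* Defs.v *)
From Stdlib Require Import Reals.
From Coquelicot Require Import Coquelicot.

Open Scope R_scope.

Definition unit_disk (z : C) : Prop := Cmod z < 1.

(** Real partial derivatives of [u : C -> R] with respect to [x] and [y],
    where [z = (x, y)] stands for [x + iy].  [Dx] and [Dy] are total; they
    mean something at [z] only when [ex_Dx u z], resp. [ex_Dy u z], holds. *)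
Definition ex_Dx (u : C -> R) (z : C) : Prop :=
  ex_derive (fun x : R => u (x, Im z)) (Re z).
Definition ex_Dy (u : C -> R) (z : C) : Prop :=
  ex_derive (fun y : R => u (Re z, y)) (Im z).
Definition Dx (u : C -> R) (z : C) : R :=
  Derive (fun x : R => u (x, Im z)) (Re z).
Definition Dy (u : C -> R) (z : C) : R :=
  Derive (fun y : R => u (Re z, y)) (Im z).

(** Class C^k on [D] (meant for open [D]): all partial derivatives of order
    at most [k] exist and are continuous on [D]. *)
Fixpoint class_C (k : nat) (D : C -> Prop) (u : C -> R) : Prop :=
  (forall z, D z -> continuous u z) /\
  match k with
  | O => True
  | S k' => (forall z, D z -> ex_Dx u z /\ ex_Dy u z) /\
            class_C k' D (Dx u) /\ class_C k' D (Dy u)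
  end.

Definition real_harmonic (D : C -> Prop) (u : C -> R) : Prop :=
  class_C 2 D u /\ (forall z, D z -> Dx (Dx u) z + Dy (Dy u) z = 0).

Definition harmonic_mapping (D : C -> Prop) (f : C -> C) : Prop :=
  real_harmonic D (fun z => Re (f z)) /\ real_harmonic D (fun z => Im (f z)).

Definition d_x (f : C -> C) (z : C) : C :=
  (Dx (fun w => Re (f w)) z, Dx (fun w => Im (f w)) z).
Definition d_y (f : C -> C) (z : C) : C :=
  (Dy (fun w => Re (f w)) z, Dy (fun w => Im (f w)) z).
Definition d_z (f : C -> C) (z : C) : C :=
  (/ 2 * (d_x f z - Ci * d_y f z))%C.
Definition d_zbar (f : C -> C) (z : C) : C :=
  (/ 2 * (d_x f z + Ci * d_y f z))%C.

Definition lambda (f : C -> C) (z : C) : R :=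
  Rabs (Cmod (d_z f z) - Cmod (d_zbar f z)).

(** [h z] is the sum of [a n * z ^ n] over [n >= 1], for every [z] in the unit
    disk (so [h] is analytic there, with [h 0 = 0]); [a 0] is not used. *)
Definition analytic_expansion (h : C -> C) (a : nat -> C) : Prop :=
  forall z, unit_disk z -> is_series (fun n => (a (S n) * z ^ S n)%C) (h z).

Definition bounded_harmonic (M : R) (f h g : C -> C) (a b : nat -> C) : Prop :=
  harmonic_mapping unit_disk f /\
  (forall z, unit_disk z -> f z = (h z + Cconj (g z))%C) /\
  analytic_expansion h a /\
  analytic_expansion g b /\
  (forall z, unit_disk z -> Cmod (h z) + Cmod (g z) <= M).

(** The denominator does not vanish on the unit disk when [0 <= a <= M],
    [0 < M] and [2 <= n]. *)
Definition f_extremal (M a : R) (n : nat) (z : C) : C :=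
  (M * z * ((a - M * z ^ (n - 1)) / (M - a * z ^ (n - 1))))%C.

(** [f] satisfies the hypotheses and attains equality for index [n], with
    [lambda f 0 = l]. *)
Definition extremal (M : R) (n : nat) (l : R) (f : C -> C) : Prop :=
  exists (h g : C -> C) (a b : nat -> C),
    bounded_harmonic M f h g a b /\
    lambda f 0 = l /\
    Cmod (a n) + Cmod (b n) = M - (lambda f 0) ^ 2 / M.

(* Main.v *)
Require Import Defs.
From Stdlib Require Import Reals Lra Lia ZArith.
From Coquelicot Require Import Coquelicot.

(** For a unimodular constant [c] the analytic function [F = h + c g] is bounded by [M]
    and vanishes at the origin.  A bounded analytic function [F z = z * phi z] satisfies
    [M |A_n| + |A_1| ^ 2 <= M ^ 2] for [n >= 2], where the [A_j] are its Taylor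
    coefficients: this is the classical estimate [|c_k| <= M - |c_0| ^ 2 / M] for the
    coefficients of [phi] ([schwarz_coef_bound]).  Choosing [c] such that
    [|a_n + c b_n| = |a_n| + |b_n|], and using
    [|a_1 + c b_1| >= | |a_1| - |b_1| | = lambda_f(0)], gives the estimate of the theorem
    ([harmonic_coef_bound], [lambda_0]).  Since its left side is nonnegative, it also
    forces [lambda_f(0) <= M].

    The classical estimate comes from discrete Fourier analysis.  For a polynomial bounded
    by [M] on the unit circle, averaging over roots of unity of large order against a
    kernel adapted to [c_0] and [c_k] gives it directly
    ([poly_coef_bound]).  Truncating an absolutely convergent series costs an error that
    tends to zero, and applying the result to [F] on circles of radius [r < 1], with
    [r] tending to [1], covers bounded analytic functions.

    For sharpness, [f_extremal] is [z] times the Moebius map [M (a - M w) / (M - a w)] at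
    [w = z ^ (n - 1)].  The map sends the unit disk into the disk of radius [M]
    ([moebius_bound]), and its geometric expansion shows that the first coefficient of
    [f_extremal] is [a] and the [n]-th is [- (M - a ^ 2 / M)] ([extremal_expansion]).
    Harmonicity holds because real parts of holomorphic functions are harmonic
    ([holo_real_harmonic]); the conjugate is handled by exchanging the roles of [h]
    and [g]. *)

Set Bullet Behavior "Strict Subproofs".

(** * Unimodular numbers *)

(** Structure projections such as [AbelianMonoid.sort C_AbelianMonoid] hide the
    carrier [C] from [ring] and [field]. *)
Ltac C_carrier :=
  try change (@plus C_AbelianMonoid) with Cplus;
  lazymatch goal with |- @eq _ ?x ?y => change (@eq C x y) end.

Definition cis (t : R) : C := (cos t, sin t).

Lemma cis_add (s t : R) : cis (s + t) = (cis s * cis t)%C.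
Proof.
  unfold cis, Cmult; cbn. rewrite cos_plus, sin_plus. f_equal; ring.
Qed.

Lemma cis_0 : cis 0 = 1.
Proof. unfold cis. now rewrite cos_0, sin_0. Qed.

Lemma Cmod_cis (t : R) : Cmod (cis t) = 1.
Proof.
  unfold cis, Cmod; cbn [fst snd]. rewrite <- sqrt_1. f_equal.
  generalize (sin2_cos2 t). unfold Rsqr. lra.
Qed.

Lemma Cconj_cis (t : R) : Cconj (cis t) = cis (- t).
Proof. unfold cis, Cconj; cbn. now rewrite cos_neg, sin_neg. Qed.

Lemma cis_pow (t : R) (n : nat) : (cis t ^ n)%C = cis (INR n * t).
Proof.
  induction n as [|n IH].
  - cbn. now rewrite Rmult_0_l, cis_0.
  - rewrite Cpow_S, IH, S_INR, <- cis_add. f_equal. ring.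
Qed.

Lemma cis_2PI_Z (m : Z) : cis (2 * (IZR m * PI)) = 1.
Proof.
  assert (H : sin (IZR m * PI) = 0) by (apply sin_eq_0_1; now exists m).
  unfold cis. rewrite cos_2a_sin, sin_2a, H.
  unfold RtoC. f_equal; ring.
Qed.

(** [1 - cos x = 2 sin (x / 2) ^ 2], so [x / 2] is a zero of the sine. *)
Lemma cis_eq_1 (x : R) : cis x = 1 -> exists m : Z, x = 2 * (IZR m * PI).
Proof.
  intros H. apply (f_equal fst) in H. cbn in H.
  replace x with (2 * (x / 2)) in H by field.
  rewrite cos_2a_sin in H.
  destruct (sin_eq_0_0 (x / 2)) as [m Hm].
  { assert (E : sin (x / 2) * sin (x / 2) = 0) by lra.
    destruct (Rmult_integral _ _ E); assumption. }
  exists m. lra.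
Qed.

Lemma phase_exists (z : C) : exists e : C, Cmod e = 1 /\ z = (Cmod z * e)%C.
Proof.
  destruct (Ceq_dec z 0) as [-> | Hz].
  - exists 1. rewrite Cmod_1, Cmod_0. split; [reflexivity | ring].
  - assert (Hm : Cmod z <> 0) by (intros E; apply Hz; now apply Cmod_eq_0).
    assert (HC : RtoC (Cmod z) <> 0) by (intros E; apply Hm; now apply RtoC_inj).
    exists (z / Cmod z)%C. split.
    + rewrite Cmod_div, Cmod_R, Rabs_pos_eq by (assumption || apply Cmod_ge_0).
      now field.
    + now field.
Qed.

Lemma conj_mul_unit (e : C) : Cmod e = 1 -> (e * Cconj e = 1)%C.
Proof. intros H. rewrite <- Cmod2_conj, H. f_equal. ring. Qed.

(** * Averages over equispaced points of the circle *)

(** Discrete stand-in for the mean over the circle: for trigonometric polynomials of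
    degree at most [N] it agrees with the integral mean, by [avg_cis]. *)
Definition avg (N : nat) (phi : R -> C) : C :=
  (/ INR (S N) * sum_n (fun j => phi (2 * PI * INR j / INR (S N))%R) N)%C.

Lemma INR_S_neq0 (N : nat) : RtoC (INR (S N)) <> 0.
Proof. intros E. apply RtoC_inj in E. now apply (not_0_INR (S N)). Qed.

Lemma avg_ext (N : nat) (phi psi : R -> C) :
  (forall t, phi t = psi t) -> avg N phi = avg N psi.
Proof. intros H. unfold avg. f_equal. apply sum_n_ext. intros j. apply H. Qed.

Lemma avg_plus (N : nat) (phi psi : R -> C) :
  avg N (fun t => phi t + psi t)%C = (avg N phi + avg N psi)%C.
Proof.
  unfold avg. rewrite <- Cmult_plus_distr_l. f_equal.
  apply (sum_n_plus (G := C_AbelianMonoid)).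
Qed.

Lemma avg_scal (N : nat) (c : C) (phi : R -> C) :
  avg N (fun t => c * phi t)%C = (c * avg N phi)%C.
Proof.
  unfold avg.
  transitivity (/ INR (S N) *
    (c * sum_n (fun j => phi (2 * PI * INR j / INR (S N))%R) N))%C; [|ring].
  f_equal. apply (sum_n_mult_l (K := C_Ring)).
Qed.

Lemma avg_const (N : nat) (c : C) : avg N (fun _ => c) = c.
Proof.
  unfold avg.
  assert (E : forall n, sum_n (fun _ : nat => c) n = (INR (S n) * c)%C).
  { induction n as [|n IH].
    - rewrite sum_O. change (INR 1) with 1. C_carrier. ring.
    - rewrite sum_Sn, IH, (S_INR (S n)), RtoC_plus.
      C_carrier. ring. }
  rewrite E. field. apply INR_S_neq0.
Qed.

Lemma avg_sum (N K : nat) (phi : nat -> R -> C) :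
  avg N (fun t => sum_n (fun l => phi l t) K) = sum_n (fun l => avg N (phi l)) K.
Proof.
  induction K as [|K IH].
  - rewrite sum_O. apply avg_ext. intros t. now rewrite sum_O.
  - rewrite sum_Sn, <- IH. change (@plus C_AbelianMonoid) with Cplus.
    rewrite <- avg_plus. apply avg_ext. intros t. now rewrite sum_Sn.
Qed.

Lemma avg_le (N : nat) (phi psi : R -> C) :
  (forall t, Cmod (phi t) <= Re (psi t)) -> Cmod (avg N phi) <= Re (avg N psi).
Proof.
  intros H.
  assert (E : forall (p q : nat -> C) n, (forall j, Cmod (p j) <= Re (q j)) ->
            Cmod (sum_n p n) <= Re (sum_n q n)).
  { intros p q n Hpq. induction n as [|n IH].
    - rewrite !sum_O. apply Hpq.
    - rewrite !sum_Sn. change (@plus C_AbelianMonoid) with Cplus.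
      eapply Rle_trans; [apply Cmod_triangle|].
      rewrite re_plus. specialize (Hpq (S n)). lra. }
  unfold avg.
  rewrite <- RtoC_inv by now apply not_0_INR.
  rewrite Cmod_mult, Cmod_R, re_scal_l.
  assert (0 < / INR (S N)) by (apply Rinv_0_lt_compat, lt_0_INR; lia).
  rewrite Rabs_pos_eq by lra.
  apply Rmult_le_compat_l; [lra|]. apply E. intros j. apply H.
Qed.

(** A geometric sum whose ratio [w] satisfies [w ^ (N + 1) = 1] and [w <> 1], the
    latter because [N + 1] does not divide the frequency [m]. *)
Lemma avg_cis (N : nat) (m : Z) :
  m <> 0%Z -> (Z.abs m <= Z.of_nat N)%Z -> avg N (fun t => cis (IZR m * t)) = 0.
Proof.
  intros Hm HN.
  assert (HS : INR (S N) <> 0) by now apply not_0_INR.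
  set (w := cis (2 * (IZR m * PI) / INR (S N))).
  assert (Hw : (w - 1)%C <> 0).
  { intros E. assert (E1 : w = 1) by (replace w with ((w - 1) + 1)%C by ring; rewrite E; ring).
    destruct (cis_eq_1 _ E1) as [q Hq].
    assert (Hq' : IZR m = IZR (q * Z.of_nat (S N))).
    { rewrite mult_IZR, <- INR_IZR_INZ.
      assert (HP := PI_RGT_0).
      apply (Rmult_eq_reg_r (2 * PI)); [|lra].
      apply (Rmult_eq_reg_r (/ INR (S N))); [|now apply Rinv_neq_0_compat].
      transitivity (2 * (IZR m * PI) / INR (S N)); [field; assumption|].
      rewrite Hq. now field. }
    apply eq_IZR in Hq'. destruct (Z.eq_dec q 0) as [-> | Hq0]; [lia|]. nia. }
  assert (G : forall n, ((w - 1) * sum_n (fun j => w ^ j)%C n = w ^ S n - 1)%C).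
  { induction n as [|n IH].
    - rewrite sum_O. cbn. C_carrier. ring.
    - rewrite sum_Sn. change (@plus C_AbelianMonoid) with Cplus.
      rewrite Cmult_plus_distr_l, IH, !Cpow_S. C_carrier. ring. }
  unfold avg.
  rewrite (sum_n_ext _ (fun j => w ^ j)%C).
  2: { intros j. unfold w. rewrite cis_pow. f_equal. now field. }
  assert (Z0 : sum_n (fun j => w ^ j)%C N = RtoC 0).
  { specialize (G N). unfold w at 3 in G. rewrite cis_pow in G.
    replace (INR (S N) * (2 * (IZR m * PI) / INR (S N))) with (2 * (IZR m * PI)) in G
      by now field.
    rewrite cis_2PI_Z in G.
    assert (G' : ((w - 1) * sum_n (fun j => w ^ j)%C N = RtoC 0)%C) by (rewrite G; ring).
    replace (sum_n (fun j => w ^ j)%C N)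
      with (/ (w - 1) * ((w - 1) * sum_n (fun j => w ^ j)%C N))%C by (field; assumption).
    rewrite G'. C_carrier. ring. }
  rewrite Z0. ring.
Qed.

Lemma avg_poly_term (N : nat) (c : nat -> C) (l : nat) (m : Z) :
  (Z.abs (Z.of_nat l + m) <= Z.of_nat N)%Z ->
  avg N (fun t => c l * cis t ^ l * cis (IZR m * t))%C =
  if Z.eq_dec (Z.of_nat l + m) 0 then c l else 0.
Proof.
  intros Hl.
  rewrite (avg_ext _ _ (fun t => c l * cis (IZR (Z.of_nat l + m) * t))%C).
  2: { intros t. rewrite cis_pow, <- Cmult_assoc, <- cis_add, plus_IZR, <- INR_IZR_INZ.
       do 2 f_equal. ring. }
  rewrite avg_scal. destruct (Z.eq_dec _ _) as [E | E].
  - rewrite E. rewrite (avg_ext _ _ (fun _ => 1)).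
    + rewrite avg_const. ring.
    + intros t. now rewrite Rmult_0_l, cis_0.
  - rewrite avg_cis by assumption. ring.
Qed.

Lemma avg_poly (N K : nat) (c : nat -> C) (m : Z) :
  avg N (fun t => sum_n (fun l => c l * cis t ^ l)%C K * cis (IZR m * t))%C =
  sum_n (fun l => avg N (fun t => c l * cis t ^ l * cis (IZR m * t))%C) K.
Proof.
  rewrite <- (avg_sum N K (fun l t => c l * cis t ^ l * cis (IZR m * t))%C).
  apply avg_ext. intros t. symmetry.
  apply (sum_n_mult_r (K := C_Ring)).
Qed.

(** Only nonnegative frequencies occur in the polynomial, so against a positive
    frequency nothing resonates; the bound on [N] excludes aliasing. *)
Lemma avg_poly_pos (N K : nat) (c : nat -> C) (k : nat) :
  (0 < k)%nat -> (K + k <= N)%nat ->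
  avg N (fun t => sum_n (fun l => c l * cis t ^ l)%C K * cis (IZR (Z.of_nat k) * t))%C = 0.
Proof.
  intros Hk HN. rewrite avg_poly.
  assert (E : forall n, (n <= K)%nat -> sum_n (fun l => avg N (fun t =>
     c l * cis t ^ l * cis (IZR (Z.of_nat k) * t))%C) n = RtoC 0).
  { induction n as [|n IH]; intros Hn.
    - rewrite sum_O, avg_poly_term by lia. now destruct (Z.eq_dec _ _); [lia|].
    - rewrite sum_Sn, IH, avg_poly_term by lia. C_carrier.
      destruct (Z.eq_dec _ _); [lia|ring]. }
  now apply E.
Qed.

Lemma avg_poly_coef (N K : nat) (c : nat -> C) (k : nat) :
  (k <= K)%nat -> (K + k <= N)%nat ->
  avg N (fun t => sum_n (fun l => c l * cis t ^ l)%C K * cis (IZR (- Z.of_nat k) * t))%C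
  = c k.
Proof.
  intros Hk HN. rewrite avg_poly.
  assert (E : forall n, (n <= K)%nat -> sum_n (fun l => avg N (fun t =>
     c l * cis t ^ l * cis (IZR (- Z.of_nat k) * t))%C) n =
     if le_dec k n then c k else RtoC 0).
  { induction n as [|n IH]; intros Hn.
    - rewrite sum_O, avg_poly_term by lia.
      destruct (Z.eq_dec _ _), (le_dec k 0); try lia; try reflexivity.
      now replace k with 0%nat by lia.
    - rewrite sum_Sn, IH, avg_poly_term by lia. C_carrier.
      destruct (Z.eq_dec _ _), (le_dec k n), (le_dec k (S n)); try lia; try ring.
      replace k with (S n) by lia. ring. }
  rewrite E by lia. now destruct (le_dec k K).
Qed.

(** * The coefficient inequality for bounded polynomials *)

(** Let [Q] be the polynomial, [d = c 0], [c k = |c k| e] with [|e| = 1] and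
    [u t = M + conj d * e * cis (k t)].  Test [Q] against the kernel
    [conj e * cis (- k t) * u t ^ 2], which has the frequencies [-k], [0] and [k].
    The first two pick out the wanted coefficients and give the mean
    [M ^ 2 |c k| + 2 M |d| ^ 2]; frequency [k] gives [0].  On the other hand the
    integrand is at most [M |u| ^ 2] in modulus, and the mean of [|u| ^ 2] is
    [M ^ 2 + |d| ^ 2].  Comparing the two and dividing by [M] yields the claim. *)
Lemma poly_coef_bound (M : R) (c : nat -> C) (K k : nat) :
  0 < M -> (0 < k <= K)%nat ->
  (forall w, Cmod w = 1 -> Cmod (sum_n (fun l => c l * w ^ l)%C K) <= M) ->
  M * Cmod (c k) + Cmod (c 0%nat) ^ 2 <= M ^ 2.
Proof.
  intros HM Hk HQ.
  set (Q := fun t => sum_n (fun l => c l * cis t ^ l)%C K).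
  set (N := (K + k)%nat).
  destruct (phase_exists (c k)) as [e [He Hck]].
  set (s := Cmod (c 0%nat)). set (d := c 0%nat).
  set (u := fun t => (M + Cconj d * e * cis (IZR (Z.of_nat k) * t))%C).
  assert (Hee := conj_mul_unit e He).
  assert (Hdd : (d * Cconj d = s ^ 2)%C) by (rewrite <- Cmod2_conj; unfold s, d; now rewrite RtoC_pow).
  assert (Hcis : forall t, (cis (IZR (Z.of_nat k) * t) * cis (IZR (- Z.of_nat k) * t) = 1)%C).
  { intros t. rewrite <- cis_add, opp_IZR, <- cis_0. f_equal. ring. }
  assert (HL : avg N (fun t => Q t * (Cconj e * cis (IZR (- Z.of_nat k) * t) * (u t * u t)))%C
               = RtoC (M * (M * Cmod (c k) + 2 * s ^ 2))).
  { rewrite (avg_ext _ _ (fun t =>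
      (M * M * Cconj e) * (Q t * cis (IZR (- Z.of_nat k) * t))
      + ((2 * M * Cconj d) * (Q t * cis (IZR (- Z.of_nat 0) * t))
         + (Cconj d * Cconj d * e) * (Q t * cis (IZR (Z.of_nat k) * t))))%C).
    - rewrite !avg_plus, !avg_scal. unfold Q.
      rewrite avg_poly_pos, !avg_poly_coef by (unfold N; lia).
      fold d. rewrite Hck, RtoC_mult, RtoC_plus, !RtoC_mult, RtoC_pow.
      replace (M * M * Cconj e * (Cmod (c k) * e))%C
        with (M * M * Cmod (c k) * (e * Cconj e))%C by ring.
      rewrite Hee.
      replace (2 * M * Cconj d * d)%C with (2 * M * (d * Cconj d))%C by ring.
      rewrite Hdd. rewrite Cmod_mult, He, Cmod_R, Rabs_pos_eq, Rmult_1_r by apply Cmod_ge_0.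
      ring.
    - intros t. unfold u. specialize (Hcis t).
      change (IZR (- Z.of_nat 0)) with 0. rewrite Rmult_0_l, cis_0.
      set (p := cis _) in Hcis |- *. set (q := cis _) in Hcis |- *.
      transitivity (M * M * Cconj e * (Q t * q)
         + (2 * M * Cconj d * (Q t * ((e * Cconj e) * (p * q)))
          + Cconj d * Cconj d * e * (Q t * (p * ((e * Cconj e) * (p * q))))))%C; [ring|].
      rewrite Hee, Hcis. ring. }
  assert (HR : avg N (fun t => M * (u t * Cconj (u t)))%C = RtoC (M * (M ^ 2 + s ^ 2))).
  { rewrite (avg_ext _ _ (fun t => M * ((M * M + s ^ 2)
      + ((M * Cconj d * e) * cis (IZR (Z.of_nat k) * t)
         + (M * d * Cconj e) * cis (IZR (- Z.of_nat k) * t))))%C).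
    - rewrite avg_scal, !avg_plus, !avg_scal, !avg_const, !avg_cis by (unfold N; lia).
      rewrite RtoC_mult, RtoC_plus, !RtoC_pow. ring.
    - intros t. unfold u. rewrite Cplus_conj, !Cmult_conj, Cconj_conj, Cconj_cis.
      replace (Cconj (RtoC M)) with (RtoC M) by (unfold Cconj, RtoC; cbn; f_equal; ring).
      replace (- (IZR (Z.of_nat k) * t)) with (IZR (- Z.of_nat k) * t)
        by (rewrite opp_IZR; ring).
      specialize (Hcis t).
      set (p := cis _) in Hcis |- *. set (q := cis _) in Hcis |- *.
      transitivity (M * (M * M + (d * Cconj d) * (e * Cconj e) * (p * q)
        + (M * Cconj d * e * p + M * d * Cconj e * q)))%C; [ring|].
      rewrite Hee, Hcis, Hdd. ring. }
  assert (HLE := avg_le N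
    (fun t => Q t * (Cconj e * cis (IZR (- Z.of_nat k) * t) * (u t * u t)))%C
    (fun t => M * (u t * Cconj (u t)))%C).
  rewrite HL, HR, Cmod_R, re_RtoC in HLE.
  assert (H1 : Rabs (M * (M * Cmod (c k) + 2 * s ^ 2)) <= M * (M ^ 2 + s ^ 2)).
  { apply HLE. intros t.
    rewrite <- Cmod2_conj, <- RtoC_mult, re_RtoC.
    rewrite !Cmod_mult, Cmod_conj, He, Cmod_cis.
    replace (1 * 1 * (Cmod (u t) * Cmod (u t))) with (Cmod (u t) ^ 2) by ring.
    apply Rmult_le_compat_r; [apply pow2_ge_0|].
    apply HQ, Cmod_cis. }
  assert (H2 := Rle_trans _ _ _ (Rle_abs _) H1).
  apply Rmult_le_reg_l in H2; [|assumption]. fold d. fold s. lra.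
Qed.

(** * From polynomials to bounded power series *)

Lemma series_remainder (c : nat -> C) (d : nat -> R) (l : C) (D : R) (N : nat) :
  is_series c l -> is_series d D ->
  (forall n, (N < n)%nat -> Cmod (c n) <= d n) ->
  Cmod (l - sum_n c N)%C <= D - sum_n d N.
Proof.
  intros Hc Hd Hle.
  assert (E : forall m, (N <= m)%nat ->
            Cmod (sum_n c m - sum_n c N)%C <= sum_n d m - sum_n d N).
  { induction m as [|m IH]; intros Hm.
    - replace N with 0%nat by lia. rewrite !Rminus_diag.
      replace (_ - _)%C with (RtoC 0) by ring. rewrite Cmod_0. lra.
    - destruct (Nat.eq_dec N (S m)) as [<- | HN].
      + rewrite !Rminus_diag.
        replace (_ - _)%C with (RtoC 0) by ring. rewrite Cmod_0. lra.
      + rewrite !sum_Sn. change (@plus C_AbelianMonoid) with Cplus.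
        change (@plus R_AbelianMonoid) with Rplus.
        replace (_ - _)%C with ((sum_n c m - sum_n c N) + c (S m))%C by ring.
        eapply Rle_trans; [apply Cmod_triangle|].
        assert (H1 := IH ltac:(lia)). assert (H2 := Hle (S m) ltac:(lia)). lra. }
  change (Rbar_le (Cmod (l - sum_n c N)%C) (D - sum_n d N)).
  apply (is_lim_seq_le_loc (fun m => Cmod (sum_n c m - sum_n c N)%C)
                           (fun m => sum_n d m - sum_n d N)).
  - exists N. exact E.
  - apply (filterlim_comp _ _ _ (fun m => sum_n c m - sum_n c N)%C Cmod _
             (locally (l - sum_n c N)%C)).
    + apply (filterlim_comp_2 (F := eventually) (sum_n c) (fun _ => opp (sum_n c N))
               (plus (G := C_NormedModule)) Hc (filterlim_const _)).
      apply (filterlim_plus (V := C_NormedModule) l (opp (sum_n c N))).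
    + apply (filterlim_norm (V := C_NormedModule)).
  - apply is_lim_seq_minus'; [exact Hd | apply is_lim_seq_const].
Qed.

(** The partial sums are bounded on the circle by [M + eps K], where the tail [eps K] of
    the series of moduli tends to [0]; apply the polynomial case and let [K] grow. *)
Lemma summable_coef_bound (M : R) (c : nat -> C) (k : nat) :
  0 < M -> (0 < k)%nat -> ex_series (fun n => Cmod (c n)) ->
  (forall w, Cmod w = 1 ->
     exists l : C, is_series (fun n => c n * w ^ n)%C l /\ Cmod l <= M) ->
  M * Cmod (c k) + Cmod (c 0%nat) ^ 2 <= M ^ 2.
Proof.
  intros HM Hk [D HD] HF.
  set (eps := fun K => D - sum_n (fun n => Cmod (c n)) K).
  assert (Hunit : forall w n, Cmod w = 1 -> Cmod (c n * w ^ n)%C <= Cmod (c n)).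
  { intros w n Hw. rewrite Cmod_mult, Cmod_pow, Hw, pow1. lra. }
  assert (Heps : is_lim_seq eps 0).
  { replace 0 with (D - D) by ring.
    apply is_lim_seq_minus'; [apply is_lim_seq_const | exact HD]. }
  assert (Hpoly : forall K, (k <= K)%nat ->
     (M + eps K) * Cmod (c k) + Cmod (c 0%nat) ^ 2 <= (M + eps K) ^ 2).
  { intros K HK.
    assert (Hrem : forall w, Cmod w = 1 -> exists l : C, Cmod l <= M /\
        Cmod (l - sum_n (fun n => c n * w ^ n)%C K) <= eps K).
    { intros w Hw. destruct (HF w Hw) as [l [Hl HlM]]. exists l. split; [exact HlM|].
      apply series_remainder; [assumption..|]. intros n _. now apply Hunit. }
    apply poly_coef_bound with K; [|lia|].
    - destruct (Hrem 1 Cmod_1) as [l [_ Hl]].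
      assert (H0 := Cmod_ge_0 (l - sum_n (fun n => c n * 1 ^ n)%C K)). lra.
    - intros w Hw. destruct (Hrem w Hw) as [l [HlM Hl]].
      set (s := sum_n _ _) in *.
      replace s with (l + - (l - s))%C by (C_carrier; ring).
      eapply Rle_trans; [apply Cmod_triangle|]. rewrite Cmod_opp. lra. }
  change (Rbar_le (M * Cmod (c k) + Cmod (c 0%nat) ^ 2) (M ^ 2)).
  assert (HMe : is_lim_seq (fun K => M + eps K) M).
  { replace (Finite M) with (Finite (M + 0)) by (f_equal; ring).
    apply is_lim_seq_plus'; [apply is_lim_seq_const | exact Heps]. }
  apply (is_lim_seq_le_loc (fun K => (M + eps K) * Cmod (c k) + Cmod (c 0%nat) ^ 2)
           (fun K => (M + eps K) ^ 2)).
  - exists k. exact Hpoly.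
  - apply is_lim_seq_plus'; [|apply is_lim_seq_const].
    apply is_lim_seq_mult'; [exact HMe | apply is_lim_seq_const].
  - apply (is_lim_seq_ext (fun K => (M + eps K) * (M + eps K))); [intros; ring|].
    replace (M ^ 2) with (M * M) by ring.
    now apply is_lim_seq_mult'.
Qed.

(** Abel's lemma: the terms are bounded at the larger radius [s = (1 + r) / 2], hence
    dominated at radius [r] by a geometric series of ratio [r / s]. *)
Lemma expansion_abs_summable (h : C -> C) (a : nat -> C) (r : R) :
  analytic_expansion h a -> 0 <= r < 1 ->
  ex_series (fun n => Cmod (a (S n)) * r ^ S n).
Proof.
  intros Ha Hr.
  set (s := (1 + r) / 2).
  assert (Hs : unit_disk (RtoC s)).
  { unfold unit_disk. rewrite Cmod_R, Rabs_pos_eq; unfold s; lra. }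
  specialize (Ha _ Hs).
  destruct (filterlim_bounded (K := C_AbsRing) (V := C_NormedModule)
              (sum_n (fun n => (a (S n) * s ^ S n)%C))) as [B HB].
  { exists (h s). exact Ha. }
  assert (Hterm : forall n, Cmod (a (S n)) * s ^ S n <= 2 * B).
  { intros n.
    assert (E : Cmod (a (S n) * s ^ S n)%C = Cmod (a (S n)) * s ^ S n).
    { rewrite Cmod_mult, Cmod_pow, Cmod_R, Rabs_pos_eq; [reflexivity|unfold s; lra]. }
    rewrite <- E. set (t := fun n => (a (S n) * s ^ S n)%C) in *.
    change (Cmod (t n) <= 2 * B).
    assert (HB' : forall m, Cmod (sum_n t m) <= B) by exact HB.
    assert (B0 : 0 <= B) by (eapply Rle_trans; [apply Cmod_ge_0 | apply (HB' 0%nat)]).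
    destruct n as [|n].
    - generalize (HB' 0%nat). rewrite sum_O. lra.
    - assert (H1 := HB' n). assert (H2 := HB' (S n)).
      rewrite sum_Sn in H2. change (@plus C_AbelianMonoid) with Cplus in H2.
      set (u := sum_n t n) in *.
      replace (t (S n)) with ((u + t (S n)) + - u)%C by (C_carrier; ring).
      eapply Rle_trans; [apply Cmod_triangle|]. rewrite Cmod_opp. lra. }
  assert (Hq : 0 <= r / s < 1).
  { split; [apply Rdiv_le_0_compat; unfold s; lra|].
    apply Rlt_div_l; unfold s; lra. }
  apply (ex_series_le (K := R_AbsRing) (V := R_CompleteNormedModule) _
           (fun n => 2 * B * (r / s) ^ n)).
  - intros n. change (Rabs (Cmod (a (S n)) * r ^ S n) <= 2 * B * (r / s) ^ n).
    assert (Hrn := pow_le r (S n) (proj1 Hr)).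
    rewrite Rabs_pos_eq by (apply Rmult_le_pos; [apply Cmod_ge_0 | assumption]).
    replace (r ^ S n) with (s ^ S n * (r / s) ^ S n).
    2: { rewrite <- Rpow_mult_distr. f_equal. field. unfold s. lra. }
    rewrite <- Rmult_assoc. specialize (Hterm n).
    assert (Hqn := pow_le _ n (proj1 Hq)).
    assert (Ht0 : 0 <= Cmod (a (S n)) * s ^ S n).
    { apply Rmult_le_pos; [apply Cmod_ge_0|apply pow_le; unfold s; lra]. }
    apply Rmult_le_compat; [assumption| now apply pow_le | assumption|].
    cbn [pow]. nra.
  - apply (ex_series_scal_l (K := R_AbsRing) (V := R_NormedModule) (2 * B)).
    exists (/ (1 - r / s)). apply is_series_geom. rewrite Rabs_pos_eq; lra.
Qed.

(** For [F z = z * phi z] the inequality is the one for [phi].  On the circle of radius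
    [r < 1] the moduli of [F] and of [F z / w], [z = r w], agree, so [M] bounds both;
    letting [r] tend to [1] removes the factors [r ^ n]. *)
Lemma schwarz_coef_bound (M : R) (F : C -> C) (A : nat -> C) (k : nat) :
  0 < M -> (0 < k)%nat -> analytic_expansion F A ->
  (forall z, unit_disk z -> Cmod (F z) <= M) ->
  M * Cmod (A (S k)) + Cmod (A 1%nat) ^ 2 <= M ^ 2.
Proof.
  intros HM Hk HA HF.
  assert (Hr : forall r, 0 <= r < 1 ->
    M * (Cmod (A (S k)) * r ^ S k) + (Cmod (A 1%nat) * r) ^ 2 <= M ^ 2).
  { intros r Hr.
    assert (Hmod : forall n, Cmod (A (S n) * r ^ S n)%C = Cmod (A (S n)) * r ^ S n).
    { intros n. rewrite Cmod_mult, Cmod_pow, Cmod_R, Rabs_pos_eq; [reflexivity|lra]. }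
    replace (Cmod (A 1%nat) * r) with (Cmod (A 1%nat) * r ^ 1) by ring.
    rewrite <- !Hmod.
    apply (summable_coef_bound M (fun n => A (S n) * r ^ S n)%C k HM Hk).
    - eapply ex_series_ext; [intros n; symmetry; apply Hmod|].
      now apply expansion_abs_summable with F.
    - intros w Hw.
      assert (Hrw : unit_disk (r * w)%C).
      { unfold unit_disk. rewrite Cmod_mult, Cmod_R, Hw, Rabs_pos_eq; lra. }
      exists (Cconj w * F (r * w))%C. split.
      + eapply is_series_ext;
          [|exact (is_series_scal_l (K := C_AbsRing) (V := C_NormedModule) (Cconj w) _ _ (HA _ Hrw))].
        intros n. change (@scal C_AbsRing C_NormedModule) with Cmult.
        C_carrier. cbv beta. rewrite Cpow_mult_l, (Cpow_S w). symmetry.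
        transitivity (A (S n) * r ^ S n * w ^ n * (w * Cconj w))%C; [|ring].
        rewrite conj_mul_unit by assumption. ring.
      + rewrite Cmod_mult, Cmod_conj, Hw, Rmult_1_l. now apply HF. }
  (* A sequence of radii increasing to 1, and the left-hand side as a function of r. *)
  set (u := fun m : nat => 1 - (1 / 2) ^ m).
  set (p := fun r => M * (Cmod (A (S k)) * r ^ S k) + (Cmod (A 1%nat) * r) ^ 2).
  assert (Hu : is_lim_seq u 1).
  { replace (Finite 1) with (Finite (1 - 0)) by (f_equal; ring).
    apply is_lim_seq_minus'; [apply is_lim_seq_const|].
    apply is_lim_seq_geom. rewrite Rabs_pos_eq; lra. }
  assert (Hp : is_lim_seq (fun m => p (u m)) (p 1)).
  { apply is_lim_seq_continuous; [|exact Hu].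
    apply continuity_pt_filterlim, (ex_derive_continuous (K := R_AbsRing) (V := R_NormedModule)).
    unfold p. auto_derive. exact I. }
  assert (H1 : Rbar_le (p 1) (M ^ 2)).
  { apply (is_lim_seq_le (fun m => p (u m)) (fun _ => M ^ 2)); [|exact Hp|apply is_lim_seq_const].
    intros m. apply Hr. unfold u.
    assert (0 < (1 / 2) ^ m <= 1); [|lra].
    split; [apply pow_lt; lra|].
    assert (Hi := pow_incr (1 / 2) 1 m). rewrite pow1 in Hi. lra. }
  cbn -[pow] in H1. unfold p in H1. rewrite pow1, !Rmult_1_r in H1. exact H1.
Qed.

(** For [|z| <= 1/2], [|z| ^ (n + 2)] is at most [4 |z| ^ 2 (1/2) ^ (n + 2)], so the
    remainder is controlled by the convergent series of moduli at radius [1/2]. *)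
Lemma expansion_first_order (h : C -> C) (a : nat -> C) :
  analytic_expansion h a ->
  exists B, forall z, Cmod z <= 1 / 2 -> Cmod (h z - a 1%nat * z)%C <= B * Cmod z ^ 2.
Proof.
  intros Ha.
  destruct (expansion_abs_summable h a (1 / 2) Ha ltac:(lra)) as [S0 HS].
  set (s := fun n => Cmod (a (S n)) * (1 / 2) ^ S n) in HS.
  exists (4 * (S0 - s 0%nat)). intros z Hz.
  assert (Hd : unit_disk z) by (unfold unit_disk; lra).
  assert (H := series_remainder (fun n => a (S n) * z ^ S n)%C
     (fun n => (2 * Cmod z) ^ 2 * s n) (h z) ((2 * Cmod z) ^ 2 * S0) 0 (Ha z Hd)).
  rewrite !sum_O, Cpow_1_r in H.
  replace (4 * (S0 - s 0%nat) * Cmod z ^ 2)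
    with ((2 * Cmod z) ^ 2 * S0 - (2 * Cmod z) ^ 2 * s 0%nat) by ring.
  apply H.
  - apply (is_series_scal_l (K := R_AbsRing) (V := R_NormedModule) ((2 * Cmod z) ^ 2)).
    exact HS.
  - intros [|n] Hn; [lia|].
    rewrite Cmod_mult, Cmod_pow. unfold s.
    assert (Hz0 := Cmod_ge_0 z).
    replace (Cmod z ^ S (S n)) with ((1 / 2) ^ S (S n) * ((2 * Cmod z) ^ 2 * (2 * Cmod z) ^ n)).
    2: { rewrite <- pow_add. change (2 + n)%nat with (S (S n)).
         rewrite <- Rpow_mult_distr. f_equal. field. }
    assert (Hn1 : 0 <= (2 * Cmod z) ^ n <= 1).
    { split; [apply pow_le; lra|].
      assert (Hi := pow_incr (2 * Cmod z) 1 n). rewrite pow1 in Hi. lra. }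
    assert (Hc : 0 <= Cmod (a (S (S n))) * (1 / 2) ^ S (S n) * (2 * Cmod z) ^ 2).
    { repeat apply Rmult_le_pos; try apply Cmod_ge_0; try apply pow_le; try apply pow2_ge_0; lra. }
    nra.
Qed.

(** * Complex derivatives and real partial derivatives *)

(** Complex differentiability, with [C] seen as a normed module over itself. *)
Notation is_C_derive f z l :=
  (@is_derive C_AbsRing (AbsRing_NormedModule C_AbsRing) f z l).

Lemma is_derive_of_quadratic (K : AbsRing) (V : NormedModule K) (f : K -> V) (x : K) (l : V)
    (B : R) :
  locally x (fun y => norm (minus (minus (f y) (f x)) (scal (minus y x) l))
                      <= B * norm (minus y x) ^ 2) ->
  is_derive f x l.
Proof.
  intros H. split; [apply is_linear_scal_l|].
  intros y Hy eps.
  apply (is_filter_lim_locally_unique (V := AbsRing_NormedModule K)) in Hy. subst y.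
  assert (HB : 0 < Rabs B + 1) by (generalize (Rabs_pos B); lra).
  assert (Hd : 0 < eps / (Rabs B + 1)) by (apply Rdiv_lt_0_compat; [apply eps|lra]).
  assert (Hn : locally x (fun y => norm (minus y x) < eps / (Rabs B + 1))).
  { apply (locally_le_locally_norm (V := AbsRing_NormedModule K)). now exists (mkposreal _ Hd). }
  generalize (filter_and _ _ H Hn). apply filter_imp. clear H Hn. intros y [H1 H2].
  eapply Rle_trans; [exact H1|].
  assert (H0 : 0 <= norm (minus y x)) by apply norm_ge_0.
  set (n := norm (minus y x)) in *.
  assert (H3 : n * (Rabs B + 1) <= eps).
  { apply Rlt_le. apply Rlt_div_r in H2; lra. }
  assert (HBle := Rle_abs B).
  apply Rle_trans with ((n * (Rabs B + 1)) * n); [|now apply Rmult_le_compat_r].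
  replace (n * (Rabs B + 1) * n) with ((Rabs B + 1) * n ^ 2) by ring.
  apply Rmult_le_compat_r; [apply pow2_ge_0|lra].
Qed.

Lemma is_C_derive_epsilon (f : C -> C) (z l : C) :
  is_C_derive f z l ->
  forall eps : posreal, exists d : posreal, forall w, Cmod (w - z) < d ->
    Cmod (f w - f z - (w - z) * l)%C <= eps * Cmod (w - z).
Proof.
  intros [_ H] eps.
  destruct (H z (fun P HP => HP) eps) as [d Hd].
  exists d. intros w Hw. exact (Hd w Hw).
Qed.

(** The curve [c] runs through [z] with constant unit velocity [v]; the directions [1]
    and [i] give the two partial derivatives. *)
Lemma derive_Re_along_line (f : C -> C) (z l v : C) (c : R -> C) (t0 : R) :
  Cmod v = 1 -> c t0 = z -> (forall t : R, (c t - z = (t - t0)%R * v)%C) ->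
  is_C_derive f z l ->
  is_derive (fun t => Re (f (c t))) t0 (Re (v * l)%C).
Proof.
  intros Hv Hz Hc Hf.
  split; [apply is_linear_scal_l|].
  intros t1 Ht1 eps.
  apply (is_filter_lim_locally_unique (V := R_NormedModule)) in Ht1. subst t1.
  destruct (is_C_derive_epsilon f z l Hf eps) as [d Hd].
  exists d. intros t Ht.
  change (Rabs (Re (f (c t)) - Re (f (c t0)) - (t - t0) * Re (v * l)%C) <= eps * Rabs (t - t0)).
  assert (E : Cmod (c t - z) = Rabs (t - t0)).
  { rewrite Hc, Cmod_mult, Hv, Cmod_R. ring. }
  specialize (Hd (c t)). rewrite E in Hd. specialize (Hd Ht).
  eapply Rle_trans; [|exact Hd].
  eapply Rle_trans; [|apply re_le_Cmod].
  apply Req_le. f_equal. rewrite Hc, Hz, <- Cmult_assoc.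
  destruct (f (c t)), (f z), (v * l)%C. cbn. ring.
Qed.

Lemma is_derive_Re_x (f : C -> C) (z l : C) :
  is_C_derive f z l -> is_derive (fun x : R => Re (f (x, Im z))) (Re z) (Re l).
Proof.
  intros H. replace (Re l) with (Re (1 * l)%C) by (f_equal; ring).
  apply (derive_Re_along_line f z l 1 (fun x => (x, Im z))); try assumption.
  - apply Cmod_1.
  - now destruct z.
  - intros t. destruct z as [x y]. unfold Cminus, Cplus, Copp, Cmult, RtoC. cbn. f_equal; ring.
Qed.

(** Moving in the imaginary direction multiplies the increment by [i]: this is the
    Cauchy-Riemann equation. *)
Lemma is_derive_Re_y (f : C -> C) (z l : C) :
  is_C_derive f z l -> is_derive (fun y : R => Re (f (Re z, y))) (Im z) (Re (Ci * l)%C).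
Proof.
  intros H.
  apply (derive_Re_along_line f z l Ci (fun y => (Re z, y))); try assumption.
  - apply Cmod_Ci.
  - now destruct z.
  - intros t. destruct z as [x y]. unfold Cminus, Cplus, Copp, Cmult, RtoC, Ci. cbn. f_equal; ring.
Qed.

Lemma is_C_derive_mult (f g : C -> C) (z df dg : C) :
  is_C_derive f z df -> is_C_derive g z dg ->
  is_C_derive (fun w => f w * g w)%C z (df * g z + f z * dg)%C.
Proof. intros Hf Hg. exact (is_derive_mult (K := C_AbsRing) f g z df dg Hf Hg Cmult_comm). Qed.

Lemma is_C_derive_plus (f g : C -> C) (z df dg : C) :
  is_C_derive f z df -> is_C_derive g z dg ->
  is_C_derive (fun w => f w + g w)%C z (df + dg)%C.
Proof. intros Hf Hg. exact (is_derive_plus (K := C_AbsRing) (V := AbsRing_NormedModule C_AbsRing) f g z df dg Hf Hg). Qed.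

Lemma is_C_derive_const (c z : C) : is_C_derive (fun _ => c) z (RtoC 0).
Proof. exact (is_derive_const (V := AbsRing_NormedModule C_AbsRing) c z). Qed.

Lemma is_C_derive_id (z : C) : is_C_derive (fun w => w) z (RtoC 1).
Proof. exact (is_derive_id (K := C_AbsRing) z). Qed.

(** The first-order error is exactly [(w - z) ^ 2 / (w z ^ 2)], and [|w| >= |z| / 2]
    near [z]. *)
Lemma is_C_derive_inv (z : C) : z <> 0 -> is_C_derive Cinv z (- (/ z * / z))%C.
Proof.
  intros Hz. assert (Hm := proj1 (Cmod_gt_0 z) Hz).
  apply is_derive_of_quadratic with (2 / Cmod z ^ 3).
  assert (Hd : 0 < Cmod z / 2) by lra.
  exists (mkposreal _ Hd). intros w Hw. change C in w.
  change (Cmod (w - z) < Cmod z / 2) in Hw.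
  change (Cmod (/ w - / z - (w - z) * - (/ z * / z))%C <= 2 / Cmod z ^ 3 * Cmod (w - z) ^ 2).
  assert (Hw2 : Cmod z / 2 <= Cmod w).
  { assert (H := Cmod_triangle w (- (w - z))%C).
    replace (w + - (w - z))%C with z in H by ring. rewrite Cmod_opp in H. lra. }
  assert (Hw0 : w <> RtoC 0) by (apply Cmod_gt_0; lra).
  replace (/ w - / z - (w - z) * - (/ z * / z))%C
    with ((w - z) * (w - z) * (/ w * (/ z * / z)))%C by (now field).
  rewrite !Cmod_mult, !Cmod_inv by assumption.
  replace (2 / Cmod z ^ 3 * Cmod (w - z) ^ 2)
    with (Cmod (w - z) * Cmod (w - z) * (/ (Cmod z / 2) * (/ Cmod z * / Cmod z))) by (field; lra).
  assert (0 < / Cmod z) by now apply Rinv_0_lt_compat.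
  apply Rmult_le_compat_l; [apply Rmult_le_pos; apply Cmod_ge_0|].
  apply Rmult_le_compat_r; [nra|].
  now apply Rinv_le_contravar.
Qed.

(** * Holomorphic functions have harmonic real parts *)

(** [f] has complex derivatives up to order [k] on [D], and the [k]-th one is
    continuous.  A graded notion, parallel to [class_C], lets both the stability rules
    and the comparison with [class_C] go by induction on [k]. *)
Fixpoint holo (k : nat) (D : C -> Prop) (f : C -> C) : Prop :=
  match k with
  | O => forall z, D z ->
      continuous (T := AbsRing_UniformSpace C_AbsRing) (U := AbsRing_UniformSpace C_AbsRing) f z
  | S k' => exists f' : C -> C, (forall z, D z -> is_C_derive f z (f' z)) /\ holo k' D f'
  end.

Lemma holo_pred (k : nat) (D : C -> Prop) (f : C -> C) : holo (S k) D f -> holo k D f.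
Proof.
  revert f. induction k as [|k IH]; intros f [f' [Hf Hf']].
  - intros z Hz.
    apply (ex_derive_continuous (K := C_AbsRing) (V := AbsRing_NormedModule C_AbsRing)).
    exists (f' z). now apply Hf.
  - exists f'. split; [exact Hf|]. now apply IH.
Qed.

Lemma holo_const (k : nat) (D : C -> Prop) (c : C) : holo k D (fun _ => c).
Proof.
  revert c. induction k as [|k IH]; intros c.
  - intros z _. apply filterlim_const.
  - exists (fun _ => RtoC 0). split; [|apply IH].
    intros z _. apply is_C_derive_const.
Qed.

Lemma holo_id (k : nat) (D : C -> Prop) : holo k D (fun z => z).
Proof.
  destruct k as [|k].
  - intros z _. apply filterlim_id.
  - exists (fun _ => RtoC 1). split; [|apply holo_const].
    intros z _. apply is_C_derive_id.
Qed.

Lemma holo_plus (k : nat) (D : C -> Prop) (f g : C -> C) :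
  holo k D f -> holo k D g -> holo k D (fun z => f z + g z)%C.
Proof.
  revert f g. induction k as [|k IH]; intros f g.
  - intros Hf Hg z Hz.
    exact (continuous_plus (U := AbsRing_UniformSpace C_AbsRing) (V := AbsRing_NormedModule C_AbsRing) f g z (Hf z Hz) (Hg z Hz)).
  - intros [f' [Hf Hf']] [g' [Hg Hg']].
    exists (fun z => f' z + g' z)%C. split; [|now apply IH].
    intros z Hz. apply is_C_derive_plus; auto.
Qed.

(** The derivative [f' g + f g'] also involves [f] and [g] themselves, which are of one
    order more than the induction asks for. *)
Lemma holo_mult (k : nat) (D : C -> Prop) (f g : C -> C) :
  holo k D f -> holo k D g -> holo k D (fun z => f z * g z)%C.
Proof.
  revert f g. induction k as [|k IH]; intros f g.
  - intros Hf Hg z Hz.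
    exact (continuous_mult (U := AbsRing_UniformSpace C_AbsRing) (K := C_AbsRing) f g z (Hf z Hz) (Hg z Hz)).
  - intros Hf0 Hg0.
    assert (Hf1 := holo_pred _ _ _ Hf0). assert (Hg1 := holo_pred _ _ _ Hg0).
    destruct Hf0 as [f' [Hf Hf']], Hg0 as [g' [Hg Hg']].
    exists (fun z => f' z * g z + f z * g' z)%C. split.
    + intros z Hz. apply is_C_derive_mult; auto.
    + apply holo_plus; now apply IH.
Qed.

Lemma holo_opp (k : nat) (D : C -> Prop) (f : C -> C) :
  holo k D f -> holo k D (fun z => - f z)%C.
Proof.
  revert f. induction k as [|k IH]; intros f.
  - intros Hf z Hz.
    exact (continuous_opp (U := AbsRing_UniformSpace C_AbsRing) (V := AbsRing_NormedModule C_AbsRing) f z (Hf z Hz)).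
  - intros [f' [Hf Hf']].
    exists (fun z => - f' z)%C. split; [|now apply IH].
    intros z Hz. exact (is_derive_opp (K := C_AbsRing) (V := AbsRing_NormedModule C_AbsRing) f z (f' z) (Hf z Hz)).
Qed.

(** One order is given up so that at [k = 0] continuity follows from differentiability. *)
Lemma holo_inv (k : nat) (D : C -> Prop) (f : C -> C) :
  (forall z, D z -> f z <> 0) -> holo (S k) D f -> holo k D (fun z => / f z)%C.
Proof.
  intros Hnz.
  assert (Hder : forall f' z, D z -> is_C_derive f z (f' z) ->
            is_C_derive (fun w => / f w)%C z (f' z * - (/ f z * / f z))%C).
  { intros f' z Hz Hf.
    exact (is_derive_comp (K := C_AbsRing) (V := AbsRing_NormedModule C_AbsRing) Cinv f z _ _
             (is_C_derive_inv _ (Hnz z Hz)) Hf). }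
  induction k as [|k IH]; intros Hf0.
  - destruct Hf0 as [f' [Hf _]]. intros z Hz.
    apply (ex_derive_continuous (K := C_AbsRing) (V := AbsRing_NormedModule C_AbsRing)).
    eexists. now apply Hder, Hf.
  - assert (Hi := IH (holo_pred _ _ _ Hf0)).
    destruct Hf0 as [f' [Hf Hf']].
    exists (fun z => f' z * - (/ f z * / f z))%C. split.
    + intros z Hz. now apply Hder, Hf.
    + apply holo_mult; [now apply holo_pred|]. apply holo_opp, holo_mult; exact Hi.
Qed.

Lemma holo_pow (k : nat) (D : C -> Prop) (n : nat) : holo k D (fun z => z ^ n)%C.
Proof.
  induction n as [|n IH].
  - exact (holo_const k D 1).
  - apply (holo_mult k D (fun z => z) (fun z => z ^ n)%C); [apply holo_id | exact IH].
Qed.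

Lemma open_line_x (D : C -> Prop) (z : C) :
  open D -> D z -> locally (Re z) (fun x => D (x, Im z)).
Proof.
  intros HD Hz. destruct (HD z Hz) as [d Hd].
  exists d. intros x Hx. apply Hd. split; [exact Hx | apply ball_center].
Qed.

Lemma open_line_y (D : C -> Prop) (z : C) :
  open D -> D z -> locally (Im z) (fun y => D (Re z, y)).
Proof.
  intros HD Hz. destruct (HD z Hz) as [d Hd].
  exists d. intros y Hy. apply Hd. split; [apply ball_center | exact Hy].
Qed.

Lemma Dx_ext (D : C -> Prop) (u v : C -> R) (z : C) :
  open D -> (forall w, D w -> u w = v w) -> D z -> Defs.Dx u z = Defs.Dx v z.
Proof.
  intros HD Huv Hz. apply Derive_ext_loc.
  generalize (open_line_x D z HD Hz). apply filter_imp. auto.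
Qed.

Lemma Dy_ext (D : C -> Prop) (u v : C -> R) (z : C) :
  open D -> (forall w, D w -> u w = v w) -> D z -> Dy u z = Dy v z.
Proof.
  intros HD Huv Hz. apply Derive_ext_loc.
  generalize (open_line_y D z HD Hz). apply filter_imp. auto.
Qed.

(** Partial derivatives of all orders at a point of an open set see only the values
    on that set; needed because the partial derivatives are identified with real parts
    of complex derivatives on [D] only. *)
Lemma class_C_ext (D : C -> Prop) (k : nat) (u v : C -> R) :
  open D -> (forall w, D w -> u w = v w) -> class_C k D u -> class_C k D v.
Proof.
  intros HD. revert u v. induction k as [|k IH]; intros u v Huv; cbn.
  - intros [Hu _]. split; [|exact I].
    intros z Hz. apply (continuous_ext_loc v u); [|auto].
    generalize (HD z Hz). apply filter_imp. auto.
  - intros [Hu [Hex [Hx Hy]]]. repeat split.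
    + intros z Hz. apply (continuous_ext_loc v u); [|auto].
      generalize (HD z Hz). apply filter_imp. auto.
    + apply (ex_derive_ext_loc (fun x : R => u (x, Im z))); [|now apply Hex].
      generalize (open_line_x D z HD H). apply filter_imp. auto.
    + apply (ex_derive_ext_loc (fun y : R => u (Re z, y))); [|now apply Hex].
      generalize (open_line_y D z HD H). apply filter_imp. auto.
    + apply (IH (Defs.Dx u)); [|exact Hx]. intros w Hw. now apply Dx_ext with D.
    + apply (IH (Dy u)); [|exact Hy]. intros w Hw. now apply Dy_ext with D.
Qed.

Lemma holo_continuous_Re (k : nat) (D : C -> Prop) (f : C -> C) (z : C) :
  holo k D f -> D z -> continuous (fun w : C => Re (f w)) z.
Proof.
  intros Hf Hz. assert (H0 : holo 0 D f).
  { induction k as [|k IH]; [exact Hf|]. now apply IH, holo_pred. }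
  specialize (H0 z Hz).
  intros P [eps HP].
  apply locally_C. apply (H0 (fun w => P (Re w))).
  exists eps. intros w Hw. apply HP.
  change (Rabs (Re w - Re (f z)) < eps).
  eapply Rle_lt_trans; [|exact Hw].
  change (Rabs (Re w - Re (f z)) <= Cmod (w - f z)).
  replace (Re w - Re (f z)) with (Re (w - f z)%C) by (destruct w, (f z); reflexivity).
  apply re_le_Cmod.
Qed.

Lemma Dx_Re (f : C -> C) (z l : C) : is_C_derive f z l -> Defs.Dx (fun w => Re (f w)) z = Re l.
Proof. intros H. apply is_derive_unique. now apply is_derive_Re_x. Qed.

Lemma Dy_Re (f : C -> C) (z l : C) :
  is_C_derive f z l -> Dy (fun w => Re (f w)) z = Re (Ci * l)%C.
Proof. intros H. apply is_derive_unique. now apply is_derive_Re_y. Qed.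

(** By [Dx_Re] and [Dy_Re] the partial derivatives of [Re f] are the real parts of
    [f'] and [i f'], to which the induction hypothesis applies. *)
Lemma holo_class_C (k : nat) (D : C -> Prop) (f : C -> C) :
  open D -> holo k D f -> class_C k D (fun z => Re (f z)).
Proof.
  intros HD. revert f. induction k as [|k IH]; intros f Hf.
  - split; [|exact I]. intros z Hz. now apply holo_continuous_Re with 0%nat D.
  - split; [intros z Hz; now apply holo_continuous_Re with (S k) D|].
    destruct Hf as [f' [Hf Hf']]. repeat split.
    + eexists. now apply is_derive_Re_x, Hf.
    + eexists. now apply is_derive_Re_y, Hf.
    + apply class_C_ext with (fun z => Re (f' z)); [exact HD| |now apply IH].
      intros w Hw. symmetry. now apply Dx_Re, Hf.
    + apply class_C_ext with (fun z => Re (Ci * f' z)%C); [exact HD| |].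
      * intros w Hw. symmetry. now apply Dy_Re, Hf.
      * apply (IH (fun z => Ci * f' z)%C). apply holo_mult; [apply holo_const | exact Hf'].
Qed.

(** [Re f''] and [Re (i (i f''))] cancel. *)
Lemma holo_real_harmonic (D : C -> Prop) (f : C -> C) :
  open D -> holo 2 D f -> real_harmonic D (fun z => Re (f z)).
Proof.
  intros HD Hf. split; [now apply holo_class_C|].
  destruct Hf as [f' [Hf [f'' [Hf' _]]]]. intros z Hz.
  rewrite (Dx_ext D _ (fun w => Re (f' w))); [|exact HD| |exact Hz].
  2: { intros w Hw. now apply Dx_Re, Hf. }
  rewrite (Dy_ext D (Dy _) (fun w => Re (Ci * f' w)%C)); [|exact HD| |exact Hz].
  2: { intros w Hw. now apply Dy_Re, Hf. }
  rewrite (Dx_Re f' z (f'' z)) by now apply Hf'.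
  rewrite (Dy_Re (fun w => Ci * f' w)%C z (0 * f' z + Ci * f'' z)%C).
  - destruct (f' z), (f'' z). cbn. ring.
  - apply (is_C_derive_mult (fun _ => Ci) f'); [apply is_C_derive_const | now apply Hf'].
Qed.

(** [Im f] is the real part of [- i f], and the imaginary part of the conjugate is the
    real part of [i f]. *)
Lemma holo_harmonic_mapping (D : C -> Prop) (f : C -> C) :
  open D -> holo 2 D f ->
  harmonic_mapping D f /\ harmonic_mapping D (fun z => Cconj (f z)).
Proof.
  intros HD Hf.
  assert (Ext : forall u v : C -> R, (forall z, u z = v z) -> real_harmonic D u -> real_harmonic D v).
  { intros u v Huv [Hu1 Hu2]. split; [now apply class_C_ext with u|].
    intros z Hz. rewrite <- (Hu2 z Hz). symmetry. f_equal.
    - apply Dx_ext with D; [exact HD| |exact Hz]. intros w Hw. now apply Dx_ext with D.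
    - apply Dy_ext with D; [exact HD| |exact Hz]. intros w Hw. now apply Dy_ext with D. }
  assert (Hc : forall c, real_harmonic D (fun z => Re (c * f z)%C)).
  { intros c. apply (holo_real_harmonic D (fun z => c * f z)%C HD).
    apply holo_mult; [apply holo_const | exact Hf]. }
  split; split; cbn beta.
  - apply (Ext (fun z => Re (1 * f z)%C)); [|apply Hc]. intros z. f_equal. ring.
  - apply (Ext (fun z => Re (- Ci * f z)%C)); [|apply Hc].
    intros z. destruct (f z). cbn. ring.
  - apply (Ext (fun z => Re (1 * f z)%C)); [|apply Hc]. intros z. destruct (f z). cbn. ring.
  - apply (Ext (fun z => Re (Ci * f z)%C)); [|apply Hc]. intros z. destruct (f z). cbn. ring.
Qed.

(** * The coefficient estimate for harmonic mappings *)

(** Apply [schwarz_coef_bound] to [h + c g], where the unimodular [c] rotates [b n] onto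
    the direction of [a n]: then [|a n + c b n| = |a n| + |b n|], while
    [|a 1 + c b 1| >= | |a 1| - |b 1| |] whatever [c] is. *)
Lemma harmonic_coef_bound (M : R) (h g : C -> C) (a b : nat -> C) (n : nat) :
  0 < M -> (2 <= n)%nat -> analytic_expansion h a -> analytic_expansion g b ->
  (forall z, unit_disk z -> Cmod (h z) + Cmod (g z) <= M) ->
  Cmod (a n) + Cmod (b n) <= M - (Cmod (a 1%nat) - Cmod (b 1%nat)) ^ 2 / M.
Proof.
  intros HM Hn Ha Hb Hhg.
  destruct (phase_exists (a n)) as [ea [Hea Han]].
  destruct (phase_exists (b n)) as [eb [Heb Hbn]].
  set (c := (ea * Cconj eb)%C).
  assert (Hc : Cmod c = 1) by (unfold c; rewrite Cmod_mult, Cmod_conj, Hea, Heb; ring).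
  assert (H : M * Cmod (a n + c * b n)%C + Cmod (a 1%nat + c * b 1%nat)%C ^ 2 <= M ^ 2).
  { replace n with (S (n - 1)) by lia.
    apply (schwarz_coef_bound M (fun z => h z + c * g z)%C (fun j => a j + c * b j)%C);
      [assumption | lia | |].
    - intros z Hz.
      eapply is_series_ext;
        [|exact (is_series_plus _ _ _ _ (Ha z Hz)
                   (is_series_scal_l (K := C_AbsRing) (V := C_NormedModule) c _ _ (Hb z Hz)))].
      intros j. change (@scal C_AbsRing C_NormedModule) with Cmult.
      change (@plus C_NormedModule) with Cplus. C_carrier. cbv beta. ring.
    - intros z Hz. eapply Rle_trans; [apply Cmod_triangle|].
      rewrite Cmod_mult, Hc, Rmult_1_l. now apply Hhg. }
  assert (E : Cmod (a n + c * b n)%C = Cmod (a n) + Cmod (b n)).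
  { replace (a n + c * b n)%C with (RtoC (Cmod (a n) + Cmod (b n)) * ea)%C.
    - rewrite Cmod_mult, Hea, Cmod_R, Rabs_pos_eq; [ring|].
      generalize (Cmod_ge_0 (a n)) (Cmod_ge_0 (b n)). lra.
    - rewrite Han, Hbn at 2. rewrite RtoC_plus. unfold c.
      transitivity (Cmod (a n) * ea + Cmod (b n) * ea * (eb * Cconj eb))%C; [|ring].
      rewrite conj_mul_unit by assumption. ring. }
  rewrite E in H.
  assert (H1 : (Cmod (a 1%nat) - Cmod (b 1%nat)) ^ 2 <= Cmod (a 1%nat + c * b 1%nat)%C ^ 2).
  { rewrite <- pow2_abs. apply pow_incr. split; [apply Rabs_pos|].
    assert (T1 := Cmod_triangle (a 1%nat + c * b 1%nat) (- (c * b 1%nat))).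
    assert (T2 := Cmod_triangle (a 1%nat + c * b 1%nat) (- a 1%nat)).
    replace (a 1%nat + c * b 1%nat + - (c * b 1%nat))%C with (a 1%nat) in T1 by ring.
    replace (a 1%nat + c * b 1%nat + - a 1%nat)%C with (c * b 1%nat)%C in T2 by ring.
    rewrite Cmod_opp, Cmod_mult, Hc in T1. rewrite Cmod_opp, Cmod_mult, Hc in T2.
    apply Rabs_le. lra. }
  apply (Rmult_le_reg_l M); [assumption|].
  replace (M * (M - (Cmod (a 1%nat) - Cmod (b 1%nat)) ^ 2 / M))
    with (M ^ 2 - (Cmod (a 1%nat) - Cmod (b 1%nat)) ^ 2) by (field; lra).
  lra.
Qed.

(** * The value of lambda at the origin *)

Lemma open_unit_disk : open unit_disk.
Proof.
  apply (open_comp Cmod (fun x => x < 1)); [|apply open_lt].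
  intros z _. apply (filterlim_norm (V := C_NormedModule) z).
Qed.

Lemma unit_disk_0 : unit_disk 0.
Proof. unfold unit_disk. rewrite Cmod_0. lra. Qed.

Lemma expansion_derive_0 (h : C -> C) (a : nat -> C) :
  analytic_expansion h a -> is_C_derive h (RtoC 0) (a 1%nat).
Proof.
  intros Ha. destruct (expansion_first_order h a Ha) as [B HB].
  assert (H0 : h (RtoC 0) = RtoC 0).
  { assert (H := HB (RtoC 0)). rewrite Cmod_0 in H. specialize (H ltac:(lra)).
    apply Cmod_eq_0. apply Rle_antisym; [|apply Cmod_ge_0].
    replace (h (RtoC 0)) with (h (RtoC 0) - a 1%nat * 0)%C by ring. lra. }
  apply is_derive_of_quadratic with B.
  assert (Hd : 0 < 1 / 2) by lra.
  exists (mkposreal _ Hd). intros z Hz. change C in z.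
  change (Cmod (z - 0) < 1 / 2) in Hz.
  change (Cmod (h z - h (RtoC 0) - (z - 0) * a 1%nat)%C <= B * Cmod (z - 0) ^ 2).
  replace (z - 0)%C with z in * by ring.
  rewrite H0.
  replace (h z - 0 - z * a 1%nat)%C with (h z - a 1%nat * z)%C by ring.
  apply HB. lra.
Qed.

(** [Re f] and [Im f] are the real parts of [h + g] and of [- i (h - g)], so the complex
    derivatives of these two functions give [f_z = a 1] and [f_zbar = conj (b 1)]
    at [0]. *)
Lemma lambda_0 (f h g : C -> C) (a b : nat -> C) :
  (forall z, unit_disk z -> f z = (h z + Cconj (g z))%C) ->
  analytic_expansion h a -> analytic_expansion g b ->
  lambda f 0 = Rabs (Cmod (a 1%nat) - Cmod (b 1%nat)).
Proof.
  intros Hf Ha Hb.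
  assert (Dh := expansion_derive_0 h a Ha). assert (Dg := expansion_derive_0 g b Hb).
  set (p := fun z => (h z + g z)%C). set (q := fun z => (- Ci * (h z + - (1) * g z))%C).
  assert (Dp : is_C_derive p (RtoC 0) (a 1%nat + b 1%nat)%C) by now apply is_C_derive_plus.
  assert (Dq : is_C_derive q (RtoC 0) (0 * (h (RtoC 0) + - (1) * g (RtoC 0)) +
      - Ci * (a 1%nat + (0 * g (RtoC 0) + - (1) * b 1%nat)))%C).
  { apply (is_C_derive_mult (fun _ => - Ci)%C (fun z => h z + - (1) * g z)%C);
      [apply is_C_derive_const|].
    apply is_C_derive_plus; [exact Dh|].
    apply (is_C_derive_mult (fun _ => - (1))%C); [apply is_C_derive_const | exact Dg]. }
  assert (Ep : forall w, unit_disk w -> Re (f w) = Re (p w)).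
  { intros w Hw. rewrite (Hf w Hw). unfold p. destruct (h w), (g w). reflexivity. }
  assert (Eq : forall w, unit_disk w -> Im (f w) = Re (q w)).
  { intros w Hw. rewrite (Hf w Hw). unfold q. destruct (h w), (g w). cbn. ring. }
  assert (Ex : d_x f 0 = (a 1%nat + Cconj (b 1%nat))%C).
  { unfold d_x.
    rewrite (Dx_ext _ _ _ _ open_unit_disk Ep unit_disk_0), (Dx_Re _ _ _ Dp).
    rewrite (Dx_ext _ _ _ _ open_unit_disk Eq unit_disk_0), (Dx_Re _ _ _ Dq).
    destruct (a 1%nat), (b 1%nat). cbn. unfold Cplus, Cconj. cbn. f_equal; ring. }
  assert (Ey : d_y f 0 = (Ci * (a 1%nat - Cconj (b 1%nat)))%C).
  { unfold d_y.
    rewrite (Dy_ext _ _ _ _ open_unit_disk Ep unit_disk_0), (Dy_Re _ _ _ Dp).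
    rewrite (Dy_ext _ _ _ _ open_unit_disk Eq unit_disk_0), (Dy_Re _ _ _ Dq).
    destruct (a 1%nat), (b 1%nat). cbn. unfold Cmult, Cplus, Cminus, Copp, Cconj, Ci. cbn.
    f_equal; ring. }
  assert (HCi : (Ci * Ci = - (1))%C) by (unfold Ci, Cmult, Copp, RtoC; cbn; f_equal; ring).
  unfold lambda, d_z, d_zbar. rewrite Ex, Ey.
  replace (/ 2 * (a 1%nat + Cconj (b 1%nat) - Ci * (Ci * (a 1%nat - Cconj (b 1%nat)))))%C
    with (a 1%nat).
  2: { rewrite Cmult_assoc, HCi. field. }
  replace (/ 2 * (a 1%nat + Cconj (b 1%nat) + Ci * (Ci * (a 1%nat - Cconj (b 1%nat)))))%C
    with (Cconj (b 1%nat)).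
  2: { rewrite Cmult_assoc, HCi. field. }
  now rewrite Cmod_conj.
Qed.

(** * The extremal functions *)

Lemma is_series_of_Cmod (c : nat -> C) (l : C) :
  is_lim_seq (fun n => Cmod (sum_n c n - l)%C) 0 -> is_series c l.
Proof.
  intros H P [eps HP].
  destruct (H (ball 0 eps) (locally_ball 0 eps)) as [N HN].
  exists N. intros n Hn. apply HP. apply C_NormedModule_mixin_compat1.
  specialize (HN n Hn). change (Rabs (Cmod (sum_n c n - l)%C - 0) < eps) in HN.
  rewrite Rminus_0_r, Rabs_pos_eq in HN by apply Cmod_ge_0. exact HN.
Qed.

Lemma C_geometric (x : C) : Cmod x < 1 -> is_series (fun n => x ^ n)%C (/ (1 - x))%C.
Proof.
  intros Hx.
  assert (Hx1 : (1 - x)%C <> 0).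
  { intros E. assert (E1 : x = 1) by (replace x with (1 - (1 - x))%C by ring; rewrite E; ring).
    rewrite E1, Cmod_1 in Hx. lra. }
  assert (G : forall n, (sum_n (fun j => x ^ j) n - / (1 - x) = - (x * / (1 - x)) * x ^ n)%C).
  { induction n as [|n IH].
    - rewrite sum_O. cbn. C_carrier. now field.
    - rewrite sum_Sn. change (@plus C_AbelianMonoid) with Cplus.
      replace (sum_n (fun j => x ^ j) n + x ^ S n - / (1 - x))%C
        with ((sum_n (fun j => x ^ j) n - / (1 - x)) + x ^ S n)%C by ring.
      rewrite IH, !Cpow_S. now field. }
  apply is_series_of_Cmod.
  apply is_lim_seq_ext with (fun n => Cmod (- (x * / (1 - x)))%C * Cmod x ^ n).
  - intros n. now rewrite G, Cmod_mult, Cmod_pow.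
  - replace (Finite 0) with (Finite (Cmod (- (x * / (1 - x)))%C * 0)) by (f_equal; ring).
    apply is_lim_seq_mult'; [apply is_lim_seq_const|].
    apply is_lim_seq_geom. rewrite Rabs_pos_eq; [assumption | apply Cmod_ge_0].
Qed.

(** Coefficients of the power series in [z ^ m] with coefficients [c]. *)
Definition spread (m : nat) (c : nat -> C) (j : nat) : C :=
  if Nat.eq_dec (j mod m) 0 then c (j / m)%nat else 0.

(** The partial sum up to [N] in powers of [z] is the partial sum up to [N / m] in powers
    of [z ^ m]. *)
Lemma spread_series (m : nat) (c : nat -> C) (z l : C) :
  (0 < m)%nat -> is_series (fun k => c k * (z ^ m) ^ k)%C l ->
  is_series (fun j => spread m c j * z ^ j)%C l.
Proof.
  intros Hm Hl.
  assert (E : forall N, sum_n (fun j => spread m c j * z ^ j)%C N =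
                        sum_n (fun k => c k * (z ^ m) ^ k)%C (N / m)).
  { induction N as [|N IH].
    - rewrite Nat.Div0.div_0_l, !sum_O. unfold spread.
      rewrite Nat.Div0.mod_0_l, Nat.Div0.div_0_l. reflexivity.
    - rewrite sum_Sn, IH. unfold spread.
      assert (HN := Nat.div_mod_eq N m). assert (HS := Nat.div_mod_eq (S N) m).
      assert (HNm := Nat.mod_upper_bound N m ltac:(lia)).
      assert (HSm := Nat.mod_upper_bound (S N) m ltac:(lia)).
      destruct (Nat.eq_dec (S N mod m) 0) as [H0 | H0].
      + assert (EQ : (S N / m = S (N / m))%nat) by nia.
        rewrite EQ, sum_Sn. f_equal. f_equal.
        rewrite <- Cpow_mult_r. f_equal. nia.
      + assert (EQ : (S N / m = N / m)%nat) by nia.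
        rewrite EQ. C_carrier. ring. }
  unfold is_series. eapply filterlim_ext; [intros N; symmetry; apply E|].
  apply (filterlim_comp _ _ _ (fun N => N / m)%nat _ _ eventually); [|exact Hl].
  intros P [K HK]. exists (K * m)%nat. intros N HN. apply HK.
  apply Nat.div_le_lower_bound; nia.
Qed.

(** Taylor coefficients at [0] of [w |-> M (a - M w) / (M - a w)]. *)
Definition moebius_coef (M a : R) (k : nat) : C :=
  match k with
  | O => RtoC a
  | S j => RtoC (- (M - a ^ 2 / M) * (a / M) ^ j)
  end.

Lemma moebius_den_neq0 (M a : R) (w : C) :
  0 < M -> 0 <= a <= M -> Cmod w < 1 -> (M - a * w)%C <> 0.
Proof.
  intros HM Ha Hw E.
  assert (E1 : RtoC M = (a * w)%C) by (replace (RtoC M) with (M - a * w + a * w)%C by ring; rewrite E; ring).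
  apply (f_equal Cmod) in E1.
  rewrite Cmod_mult, !Cmod_R, !Rabs_pos_eq in E1 by lra.
  generalize (Cmod_ge_0 w). nra.
Qed.

(** Dividing, [M (a - M w) / (M - a w) = a - (M - a ^ 2 / M) w / (1 - q w)] with
    [q = a / M]; expand the last quotient as a geometric series. *)
Lemma moebius_series (M a : R) (w : C) :
  0 < M -> 0 <= a <= M -> Cmod w < 1 ->
  is_series (fun k => moebius_coef M a k * w ^ k)%C (M * ((a - M * w) / (M - a * w)))%C.
Proof.
  intros HM Ha Hw.
  assert (HD := moebius_den_neq0 M a w HM Ha Hw).
  assert (HMC : RtoC M <> 0) by (intros E; apply RtoC_inj in E; lra).
  set (q := a / M).
  assert (Hq : 0 <= q <= 1).
  { unfold q. split; [apply Rdiv_le_0_compat; lra|]. apply Rle_div_l; lra. }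
  assert (HG : is_series (fun n => (q * w) ^ n)%C (/ (1 - q * w))%C).
  { apply C_geometric. rewrite Cmod_mult, Cmod_R, Rabs_pos_eq by lra.
    generalize (Cmod_ge_0 w). nra. }
  apply (is_series_scal_l (K := C_AbsRing) (V := C_NormedModule)
           (- (M - a ^ 2 / M) * w)%C) in HG.
  apply is_series_decr_1.
  eapply is_series_ext.
  2: { replace (plus _ _) with (scal (K := C_AbsRing) (V := C_NormedModule)
         (- (M - a ^ 2 / M) * w)%C (/ (1 - q * w))%C); [exact HG|].
       change (- (M - a ^ 2 / M) * w * / (1 - q * w) =
         M * ((a - M * w) / (M - a * w)) + - (a * 1))%C.
       unfold q. rewrite RtoC_div by lra. field. repeat split; try assumption. }
  intros n. change (- (M - a ^ 2 / M) * w * (q * w) ^ n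
     = RtoC (- (M - a ^ 2 / M) * q ^ n) * w ^ S n)%C.
  rewrite (Cpow_S w), Cpow_mult_l, RtoC_mult, RtoC_pow, RtoC_opp, RtoC_minus, RtoC_div, !RtoC_pow by lra.
  ring.
Qed.

(** [|M - a w| ^ 2 - |a - M w| ^ 2 = (M ^ 2 - a ^ 2) (1 - |w| ^ 2)]. *)
Lemma moebius_bound (M a : R) (w : C) :
  0 < M -> 0 <= a <= M -> Cmod w < 1 -> Cmod ((a - M * w) / (M - a * w))%C <= 1.
Proof.
  intros HM Ha Hw.
  assert (HD := moebius_den_neq0 M a w HM Ha Hw).
  rewrite Cmod_div by assumption.
  apply Rle_div_l; [now apply Cmod_gt_0|]. rewrite Rmult_1_l.
  apply Rsqr_incr_0_var; [|apply Cmod_ge_0].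
  rewrite !Rsqr_pow2, !Cmod2_alt.
  assert (Hw2 : Re w ^ 2 + Im w ^ 2 <= 1).
  { rewrite <- Cmod2_alt. generalize (Cmod_ge_0 w). nra. }
  assert (0 <= (M ^ 2 - a ^ 2) * (1 - (Re w ^ 2 + Im w ^ 2))) by (apply Rmult_le_pos; nra).
  destruct w as [x y]. cbn in *. nra.
Qed.

Lemma pow_unit_disk (z : C) (m : nat) : (0 < m)%nat -> Cmod z < 1 -> Cmod (z ^ m)%C < 1.
Proof.
  intros Hm Hz. rewrite Cmod_pow. apply pow_lt_1_compat; [|lia].
  split; [apply Cmod_ge_0 | assumption].
Qed.

(** [f_extremal] is [z] times the Moebius map evaluated at [z ^ (n - 1)]; the factor [z]
    accounts for the shift of the index [j]. *)
Definition extremal_coef (M a : R) (n : nat) (j : nat) : C :=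
  spread (n - 1) (moebius_coef M a) (j - 1).

Lemma extremal_expansion (M a : R) (n : nat) :
  0 < M -> 0 <= a <= M -> (2 <= n)%nat ->
  analytic_expansion (f_extremal M a n) (extremal_coef M a n).
Proof.
  intros HM Ha Hn z Hz.
  assert (H := spread_series (n - 1) (moebius_coef M a) z _ ltac:(lia)
    (moebius_series M a _ HM Ha (pow_unit_disk z (n - 1) ltac:(lia) Hz))).
  apply (is_series_scal_l (K := C_AbsRing) (V := C_NormedModule) z) in H.
  unfold f_extremal.
  replace (M * z * ((a - M * z ^ (n - 1)) / (M - a * z ^ (n - 1))))%C
    with (scal (K := C_AbsRing) (V := C_NormedModule) z
      (M * ((a - M * z ^ (n - 1)) / (M - a * z ^ (n - 1))))%C).
  2: { change (@scal C_AbsRing C_NormedModule) with Cmult. C_carrier. ring. }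
  revert H. apply is_series_ext. intros j.
  change (@scal C_AbsRing C_NormedModule) with Cmult. C_carrier. cbv beta.
  unfold extremal_coef. rewrite Cpow_S. replace (S j - 1)%nat with j by lia. ring.
Qed.

Lemma zero_expansion : analytic_expansion (fun _ => RtoC 0) (fun _ => RtoC 0).
Proof.
  intros z _. apply is_series_of_Cmod.
  apply is_lim_seq_ext with (fun _ => 0); [|apply is_lim_seq_const].
  intros n. replace (sum_n _ n) with (RtoC 0).
  - replace (0 - 0)%C with (RtoC 0) by ring. now rewrite Cmod_0.
  - induction n as [|n IH].
    + rewrite sum_O. C_carrier. ring.
    + rewrite sum_Sn, <- IH. C_carrier. ring.
Qed.

Lemma f_extremal_holo (M a : R) (n : nat) :
  0 < M -> 0 <= a <= M -> (2 <= n)%nat -> holo 2 unit_disk (f_extremal M a n).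
Proof.
  intros HM Ha Hn.
  assert (Haff : forall k (c d : R), holo k unit_disk (fun z => c - d * z ^ (n - 1))%C).
  { intros k c d. apply (holo_plus k unit_disk (fun _ => RtoC c) (fun z => - (d * z ^ (n - 1)))%C).
    - apply holo_const.
    - apply (holo_opp k unit_disk (fun z => d * z ^ (n - 1))%C).
      apply (holo_mult k unit_disk (fun _ => RtoC d) (fun z => z ^ (n - 1))%C).
      + apply holo_const.
      + apply holo_pow. }
  apply (holo_mult 2 unit_disk (fun z => M * z)%C
           (fun z => (a - M * z ^ (n - 1)) / (M - a * z ^ (n - 1)))%C).
  - apply (holo_mult 2 unit_disk (fun _ => RtoC M) (fun z => z)); [apply holo_const | apply holo_id].
  - apply (holo_mult 2 unit_disk (fun z => a - M * z ^ (n - 1))%C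
             (fun z => / (M - a * z ^ (n - 1)))%C); [apply Haff|].
    apply holo_inv; [|apply Haff].
    intros z Hz. apply moebius_den_neq0; try assumption.
    apply pow_unit_disk; [lia | exact Hz].
Qed.

Lemma f_extremal_bound (M a : R) (n : nat) (z : C) :
  0 < M -> 0 <= a <= M -> (2 <= n)%nat -> unit_disk z -> Cmod (f_extremal M a n z) <= M.
Proof.
  intros HM Ha Hn Hz. unfold f_extremal.
  assert (H := moebius_bound M a (z ^ (n - 1)) HM Ha (pow_unit_disk z (n - 1) ltac:(lia) Hz)).
  rewrite Cmod_mult, Cmod_mult, Cmod_R, Rabs_pos_eq by lra.
  unfold unit_disk in Hz.
  assert (H0 := Cmod_ge_0 z).
  assert (H1 := Cmod_ge_0 ((a - M * z ^ (n - 1)) / (M - a * z ^ (n - 1)))%C).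
  set (t := Cmod (_ / _)) in *.
  apply Rle_trans with (M * Cmod z * 1); [apply Rmult_le_compat_l; [nra|assumption] | nra].
Qed.

Lemma extremal_coef_1 (M a : R) (n : nat) : extremal_coef M a n 1 = a.
Proof.
  unfold extremal_coef, spread. cbn [Nat.sub].
  now rewrite Nat.Div0.mod_0_l, Nat.Div0.div_0_l.
Qed.

Lemma extremal_coef_n (M a : R) (n : nat) :
  (2 <= n)%nat -> extremal_coef M a n n = RtoC (- (M - a ^ 2 / M)).
Proof.
  intros Hn. unfold extremal_coef, spread.
  rewrite Nat.Div0.mod_same, Nat.div_same by lia. cbn. f_equal. ring.
Qed.

Theorem lemma2p3 :
  forall M : R, 0 < M ->
    (forall (f h g : C -> C) (a b : nat -> C),
       bounded_harmonic M f h g a b ->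
       0 <= lambda f 0 <= M /\
       (forall n : nat, (2 <= n)%nat ->
          Cmod (a n) + Cmod (b n) <= M - (lambda f 0) ^ 2 / M)) /\
    (forall (n : nat) (a : R), (2 <= n)%nat -> 0 <= a <= M ->
       extremal M n a (f_extremal M a n) /\
       extremal M n a (fun z => Cconj (f_extremal M a n z))).
Proof.
  intros M HM. split.
  - intros f h g a b (_ & Hf & Ha & Hb & Hhg).
    rewrite (lambda_0 f h g a b Hf Ha Hb).
    assert (Hc : forall n, (2 <= n)%nat -> Cmod (a n) + Cmod (b n) <=
              M - Rabs (Cmod (a 1%nat) - Cmod (b 1%nat)) ^ 2 / M).
    { intros n Hn. rewrite pow2_abs. now apply harmonic_coef_bound with h g. }
    split; [split|exact Hc]; [apply Rabs_pos|].
    (* The upper bound on lambda: the estimate for n = 2 has a nonnegative left side. *)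
    specialize (Hc 2%nat (le_n 2)).
    set (t := Rabs _) in *.
    assert (H0 : 0 <= M - t ^ 2 / M).
    { generalize (Cmod_ge_0 (a 2%nat)) (Cmod_ge_0 (b 2%nat)). lra. }
    assert (H1 : t ^ 2 <= M ^ 2).
    { replace (t ^ 2) with (M * (t ^ 2 / M)) by (field; lra). nra. }
    apply Rsqr_incr_0_var; [|lra]. now rewrite !Rsqr_pow2.
  - intros n a Hn Ha.
    set (F := f_extremal M a n).
    assert (HF := extremal_expansion M a n HM Ha Hn).
    destruct (holo_harmonic_mapping _ _ open_unit_disk (f_extremal_holo M a n HM Ha Hn))
      as [Hh Hh'].
    assert (HB : forall z, unit_disk z -> Cmod (F z) <= M)
      by (intros z Hz; now apply f_extremal_bound).
    assert (Hc0 : Cconj 0 = 0) by (unfold Cconj, RtoC; cbn; f_equal; ring).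
    assert (Hsq : a ^ 2 / M <= M).
    { apply Rle_div_l; [assumption|]. nra. }
    assert (Hn' : Cmod (extremal_coef M a n n) = M - a ^ 2 / M).
    { rewrite extremal_coef_n, Cmod_R, Rabs_Ropp, Rabs_pos_eq by (assumption || lra).
      reflexivity. }
    split.
    + exists F, (fun _ => RtoC 0), (extremal_coef M a n), (fun _ => RtoC 0).
      assert (Hf : forall z, unit_disk z -> F z = (F z + Cconj 0)%C)
        by (intros; rewrite Hc0; ring).
      assert (HL : lambda F 0 = a).
      { rewrite (lambda_0 _ _ _ _ _ Hf HF zero_expansion).
        rewrite extremal_coef_1, Cmod_0, Rminus_0_r, Cmod_R, Rabs_Rabsolu, Rabs_pos_eq; lra. }
      split; [|split; [exact HL|]].
      * repeat (split; [assumption || apply zero_expansion|]).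
        intros z Hz. rewrite Cmod_0, Rplus_0_r. now apply HB.
      * rewrite HL, Cmod_0, Hn'. ring.
    + exists (fun _ => RtoC 0), F, (fun _ => RtoC 0), (extremal_coef M a n).
      assert (Hf : forall z, unit_disk z -> Cconj (F z) = (0 + Cconj (F z))%C)
        by (intros; ring).
      assert (HL : lambda (fun z => Cconj (F z)) 0 = a).
      { rewrite (lambda_0 _ _ _ _ _ Hf zero_expansion HF).
        rewrite extremal_coef_1, Cmod_0, Rabs_minus_sym, Rminus_0_r, Cmod_R, Rabs_Rabsolu, Rabs_pos_eq; lra. }
      split; [|split; [exact HL|]].
      * repeat (split; [assumption || apply zero_expansion|]).
        intros z Hz. rewrite Cmod_0, Rplus_0_l. now apply HB.
      * rewrite HL, Cmod_0, Hn'. ring.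
Qed.
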